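(* Let $k\in\mathbb{Z}^+$ and $p\in[1,\infty)$ satisfy either (1) $p\notin\mathbb{Z}$ or (2) $p\ge k$. Then there exists a $(p,k)$-isolating parallelepiped $V\in\mathbb{R}^{2^k\times k}$, $\vec t^*\in\mathbb{R}^{2^k}$. Moreover, if $p$ is computable then there is an algorithm that on input $k$ and $p$ outputs such an isolating parallelepiped.
   Context: $\|\vec x\|_p=(\sum_i|x_i|^p)^{1/p}$. For $1\le p\le\infty$ and integer $k\ge1$, $V\in\mathbb{R}^{d^*\times k}$ and $\vec t^*\in\mathbb{R}^{d^*}$ define a $(p,k)$-isolating parallelepiped if $\|V\vec x-\vec t^*\|_p=1$ for all $\vec x\in\{0,1\}^k\setminus\{\vec 0\}$ and $\|\vec t^*\|_p>1$. *)

(* Defs.v *)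
From mathcomp Require Import all_boot all_order all_algebra.
From mathcomp Require Import archimedean reals exp.

Set Implicit Arguments.
Unset Strict Implicit.
Unset Printing Implicit Defensive.

Import Order.TTheory GRing.Theory Num.Theory.
Local Open Scope ring_scope.

Definition lpnorm (R : realType) (p : R) (d : nat) (x : 'cV[R]_d) : R :=
  (\sum_(i < d) `|x i 0| `^ p) `^ p^-1.

Definition isolating_parallelepiped (R : realType) (p : R) (d k : nat)
    (V : 'M[R]_(d, k)) (t : 'cV[R]_d) : Prop :=
  (forall x : 'cV[R]_k, (forall i, x i 0 = 0 \/ x i 0 = 1) -> x != 0 ->
     lpnorm p (V *m x - t) = 1)
  /\ 1 < lpnorm p t.

(* Programs for the partial functions on the naturals that are recursive
   relative to an oracle phi : nat -> nat (Kleene's schemes).  Programs carry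
   no arity: they take a finite list of arguments, and missing arguments of
   the basic functions are read as 0. *)
Inductive prog : Type :=
| PZero
| PSucc
| PProj of nat
| POracle
| PComp of prog & seq prog
| PRec of prog & prog
| PMu of prog.

(* [eval phi c s y]: run with oracle phi on arguments s, the program c halts
   with output y. *)
Inductive eval (phi : nat -> nat) : prog -> seq nat -> nat -> Prop :=
| EvalZero s : eval phi PZero s 0%N
| EvalSucc s : eval phi PSucc s (nth 0%N s 0%N).+1
| EvalProj i s : eval phi (PProj i) s (nth 0%N s i)
| EvalOracle s : eval phi POracle s (phi (nth 0%N s 0%N))
| EvalComp f gs s ys y :
    evals phi gs s ys -> eval phi f ys y -> eval phi (PComp f gs) s y
| EvalRec0 f g s y : eval phi f s y -> eval phi (PRec f g) (0%N :: s) y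
| EvalRecS f g n s r y :
    eval phi (PRec f g) (n :: s) r -> eval phi g [:: n, r & s] y ->
    eval phi (PRec f g) (n.+1 :: s) y
| EvalMu f s n (r : nat -> nat) :
    (forall m, (m < n)%N -> eval phi f (m :: s) (r m).+1) ->
    eval phi f (n :: s) 0%N -> eval phi (PMu f) s n
with evals (phi : nat -> nat) : seq prog -> seq nat -> seq nat -> Prop :=
| EvalNil s : evals phi [::] s [::]
| EvalCons g gs s y ys :
    eval phi g s y -> evals phi gs s ys -> evals phi (g :: gs) s (y :: ys).

Scheme eval_mind := Minimality for eval Sort Prop
  with evals_mind := Minimality for evals Sort Prop.

Lemma eval_functional phi c s y z :
  eval phi c s y -> eval phi c s z -> y = z.
Proof.
move=> H; move: z.
apply: (@eval_mind phi (fun c s y => forall z, eval phi c s z -> y = z)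
  (fun gs s ys => forall zs, evals phi gs s zs -> ys = zs) _ _ _ _ _ _ _ _ _ _
  c s y H) => {c s y H}.
- by move=> s z H; inversion H.
- by move=> s z H; inversion H.
- by move=> i s z H; inversion H.
- by move=> s z H; inversion H.
- move=> f gs s ys y _ IHgs _ IHf z H.
  inversion H as [| | | |? ? ? zs ? Hgs Hf| | |]; subst.
  by apply: IHf; rewrite (IHgs _ Hgs).
- by move=> f g s y _ IHf z H; inversion H; subst; apply: IHf.
- move=> f g n s r y _ IHr _ IHg z H.
  inversion H as [| | | | | |? ? ? ? r' ? Hr Hg|]; subst.
  by apply: IHg; rewrite (IHr _ Hr).
- move=> f s n r _ IHr _ IHn z H.
  inversion H as [| | | | | | |? ? ? r' Hr Hz]; subst.
  case: (ltngtP n z) => // lt; first by have := IHn _ (Hr _ lt).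
  by have := IHr _ lt _ Hz.
- by move=> s zs H; inversion H.
- move=> g gs s y ys _ IHg _ IHgs zs H.
  inversion H as [|? ? ? ? ? Hg Hgs]; subst.
  by rewrite (IHg _ Hg) (IHgs _ Hgs).
Qed.

(* The constantly zero oracle gives no information. *)
Definition recursive (f : nat -> nat) : Prop :=
  exists c : prog, forall n, eval (fun=> 0%N) c [:: n] (f n).

(* The bijection 0, 1, 2, 3, ... |-> 0, -1, 1, -2, ... from nat to int. *)
Definition int_of_code (m : nat) : int :=
  if odd m then Negz m./2 else Posz m./2.

(* The code m denotes a dyadic rational with denominator 2 ^ n that is within
   2 ^ - n of x. *)
Definition approximates (R : realType) (n m : nat) (x : R) : Prop :=
  `|(int_of_code m)%:~R / 2 ^+ n - x| <= 2 ^- n.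

(* Dyadic Cauchy names of real numbers, as in computable analysis. *)
Definition names (R : realType) (phi : nat -> nat) (x : R) : Prop :=
  forall n, approximates n (phi n) x.

Definition computable_real (R : realType) (x : R) : Prop :=
  exists phi, recursive phi /\ names phi x.

(* With oracle phi and input k, the program c outputs the real matrix A: from
   k, the indices of an entry and a precision n it computes a dyadic
   approximation of that entry up to 2 ^ - n. *)
Definition outputs_matrix (R : realType) (c : prog) (phi : nat -> nat) (k : nat)
    (m n : nat) (A : 'M[R]_(m, n)) : Prop :=
  forall (i : 'I_m) (j : 'I_n) (prec : nat),
    exists y, eval phi c [:: k; i : nat; j : nat; prec] y
              /\ approximates prec y (A i j).

(* Main.v *)
Require Import Defs.
From mathcomp Require Import all_boot all_order all_algebra.
From mathcomp Require Import archimedean reals exp.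
From mathcomp Require Import boolp classical_sets functions.
From mathcomp Require Import topology normedtype derive sequences realfun.
From mathcomp Require Import ring lra.

(** Index the rows by [v < 2 ^ k] through their binary digits and put
    [V v j = 2 (-1)^(v_j) c_v^(1/p)], [t v = - (1 + 2 |v|) c_v^(1/p)].
    For [x] in [{0,1}^k] the [v]-th coordinate of [V x - t] is then
    [c_v^(1/p) (1 + 2 d(v, x))] with [d] the Hamming distance, so that
    [||V x - t||_p^p = \sum_v c_v (1 + 2 d(v, x))^p] is a convolution on the
    group [(Z/2)^k].  The Walsh functions diagonalize it, and the eigenvalue at
    [S] is, up to sign, a sum of finite differences of order [|S|] of [x^p]; by
    the mean value theorem it has the sign of [p (p-1) ... (p-|S|+1)] and does
    not vanish.  Hence the convolution can be inverted: the function equal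
    to 1 everywhere except for a small bump at [x = 0] is the image of a
    positive weight [c], given by an explicit formula in [p].

    That formula uses sums, products, inverses and powers [x^y] with
    [x, y > 0], all of which preserve computability uniformly in a name of [p].
    Inverses and powers are computed by searching their Dedekind cuts, which are
    semidecidable: [z < 1/x] iff [z x < 1]; for an integer [n >= 1], [z < n^y]
    iff [z^N < n^v] for some rational number [v/N < y]; and, for integers [c]
    and [d], [c/d < x^y] iff [c^(1/y) < d^(1/y) x]. *)

Set Implicit Arguments.
Unset Strict Implicit.
Unset Printing Implicit Defensive.

Import Order.TTheory GRing.Theory Num.Theory.
Import numFieldNormedType.Exports.
Local Open Scope ring_scope.

(** * Walsh functions and convolution by radial kernels on the cube *)

Fixpoint bit (v j : nat) : bool := if j is i.+1 then bit v./2 i else odd v.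

Definition weight (k : nat) (y : nat -> bool) : nat := \sum_(j < k) y j.

Definition hamming (k : nat) (y z : nat -> bool) : nat :=
  weight k (fun j => y j (+) z j).

Definition dot (k : nat) (y z : nat -> bool) : nat :=
  weight k (fun j => y j && z j).

Lemma bitE v j : bit v j = odd (v %/ 2 ^ j).
Proof.
elim: j v => [|j IH] v /=; first by rewrite expn0 divn1.
by rewrite IH expnS divnMA divn2.
Qed.

Lemma weightS k y : weight k.+1 y = (y 0%N + weight k (y \o succn))%N.
Proof. exact: big_ord_recl. Qed.

Lemma weight_leq k y : (weight k y <= k)%N.
Proof.
rewrite -[leqRHS]card_ord -sum1_card; apply: leq_sum => j _.
exact: leq_b1.
Qed.

Lemma weight_eq0 k y : (weight k y == 0%N) = [forall j : 'I_k, ~~ y j].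
Proof. by rewrite sum_nat_eq0; apply: eq_forallb => j /=; rewrite eqb0. Qed.

Lemma sum_ltn_exp2S (V : nmodType) k (f : nat -> V) :
  \sum_(v < 2 ^ k.+1) f v = \sum_(v < 2 ^ k) (f v.*2 + f v.*2.+1).
Proof.
rewrite expnS mul2n; elim: (2 ^ k)%N => [|n IH]; first by rewrite !big_ord0.
by rewrite doubleS !big_ord_recr /= IH addrA.
Qed.

Section Walsh.
Variable R : comNzRingType.
Implicit Types (k S : nat) (y : nat -> bool) (F : nat -> R).

Definition walsh k S y : R := (-1) ^+ dot k (bit S) y.

(* [F] is read as the kernel [(y, z) |-> F (hamming k y z)]: the Walsh
   functions are the eigenvectors of the convolution by such a kernel, see
   [sum_walsh_hamming]. *)
Definition walsh_eigenvalue k F S : R :=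
  \sum_(v < 2 ^ k) walsh k S (bit v) * F (weight k (bit v)).

Lemma walshS k S y :
  walsh k.+1 S y = (-1) ^+ (odd S && y 0%N) * walsh k S./2 (y \o succn).
Proof. by rewrite /walsh /dot weightS exprD. Qed.

Lemma walsh0l k y : walsh k 0 y = 1.
Proof.
elim: k y => [|k IH] y; first by rewrite /walsh /dot /weight big_ord0.
by rewrite walshS /= IH mul1r.
Qed.

Lemma sum_walshS k S (G : bool -> nat -> R) :
  \sum_(v < 2 ^ k.+1) walsh k.+1 S (bit v) * G (odd v) v./2 =
  \sum_(v < 2 ^ k) walsh k S./2 (bit v) * G false v +
  (-1) ^+ odd S * \sum_(v < 2 ^ k) walsh k S./2 (bit v) * G true v.
Proof.
pose f v := walsh k.+1 S (bit v) * G (odd v) v./2.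
rewrite (sum_ltn_exp2S k f) mulr_sumr -big_split /=; apply: eq_bigr => v _.
rewrite /f !walshS /= -![bit _ \o succn]/(bit _./2) /= odd_double doubleK.
by rewrite uphalf_double andbF andbT mul1r mulrA.
Qed.

Lemma walsh_eigenvalueS k F S :
  walsh_eigenvalue k.+1 F S =
  walsh_eigenvalue k F S./2 +
  (-1) ^+ odd S * walsh_eigenvalue k (F \o succn) S./2.
Proof.
rewrite -(sum_walshS k S (fun b v => F (b + weight k (bit v))%N)).
by apply: eq_bigr => v _; rewrite weightS.
Qed.

Lemma sum_walsh_hamming k F S y :
  \sum_(v < 2 ^ k) walsh k S (bit v) * F (hamming k y (bit v)) =
  walsh k S y * walsh_eigenvalue k F S.
Proof.
elim: k F S y => [|k IH] F S y.
  rewrite /walsh_eigenvalue expn0 !big_ord1 /hamming /walsh /dot /weight.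
  by rewrite !big_ord0 !mul1r.
pose G b v := F ((y 0%N (+) b) + hamming k (y \o succn) (bit v))%N.
transitivity (\sum_(v < 2 ^ k.+1) walsh k.+1 S (bit v) * G (odd v) v./2).
  by apply: eq_bigr => v _; rewrite /hamming weightS.
rewrite sum_walshS walshS walsh_eigenvalueS /G.
case: (y 0%N) => /=; rewrite ?(IH (F \o succn)) ?(IH F) ?andbT ?andbF.
  by case: (odd S); rewrite ?expr0 ?expr1; ring.
by rewrite expr0; ring.
Qed.

Lemma sum_walsh k y :
  \sum_(S < 2 ^ k) walsh k S y = (2 ^ k * (weight k y == 0))%:R.
Proof.
elim: k y => [|k IH] y.
  by rewrite expn0 big_ord1 /walsh /dot /weight !big_ord0.
rewrite (sum_ltn_exp2S k (fun S => walsh k.+1 S y)) weightS addn_eq0 eqb0.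
transitivity ((1 + (-1) ^+ y 0%N) * \sum_(S < 2 ^ k) walsh k S (y \o succn)).
  rewrite mulr_sumr; apply: eq_bigr => S _.
  by rewrite !walshS /= odd_double doubleK uphalf_double mul1r mulrDl mul1r.
rewrite IH; case: (y 0%N) => /=; first by rewrite muln0 subrr mul0r.
by rewrite expnS -mulnA [RHS]natrM expr0.
Qed.

End Walsh.

Arguments walsh {R} k S y.

Section WalshDifference.
Variables (R : realType) (h : R).
Hypothesis h_gt0 : 0 < h.
Implicit Types (k S n : nat) (p x z : R) (f : R -> R).

(* The composite over [j < k] of the operators [1 + T] or, when [bit S j],
   [1 - T], where [T] is the translation by [h]; hence, up to sign, a sum of
   finite differences of order [weight k (bit S)]. *)
Definition walsh_difference k S f x : R :=
  walsh_eigenvalue k (fun d => f (x + h * d%:R)) S.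

Lemma walsh_differenceS k S f x :
  walsh_difference k.+1 S f x =
  walsh_difference k S./2 f x +
  (-1) ^+ odd S * walsh_difference k S./2 f (x + h).
Proof.
rewrite /walsh_difference walsh_eigenvalueS; congr (_ + _ * _).
by apply: eq_bigr => v _ /=; rewrite -natr1 mulrDr mulr1 addrA addrAC.
Qed.

Lemma is_derive_walsh_difference k S f f' x :
  (forall z, 0 < z -> is_derive z 1 f (f' z)) -> 0 < x ->
  is_derive x 1 (walsh_difference k S f) (walsh_difference k S f' x).
Proof.
move=> df x_gt0; have -> : walsh_difference k S f = \sum_(v < 2 ^ k)
    (walsh k S (bit v) *: (f \o shift (h * (weight k (bit v))%:R) : R -> R)).
  by apply/funext => z; rewrite fct_sumE.
apply: is_derive_sum => v; apply: is_deriveZ.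
rewrite -[X in is_derive _ _ _ X]mulr1.
apply: is_derive1_comp; last exact: is_derive_shift.
by apply: df; rewrite ltr_wpDr // mulr_ge0 // ltW.
Qed.

Lemma walsh_difference_sign (F : nat -> R -> R) (c : R) k S n x :
  (forall m z, 0 < z -> is_derive z 1 (F m) (F m.+1 z)) ->
  (forall z, 0 < z -> 0 < c * F (n + weight k (bit S))%N z) -> 0 < x ->
  0 < (-1) ^+ weight k (bit S) * c * walsh_difference k S (F n) x.
Proof.
move=> dF; elim: k S n x => [|k IH] S n x.
  rewrite /walsh_difference /walsh_eigenvalue /walsh /dot /weight expn0.
  rewrite big_ord1 !big_ord0 addn0 mulr0 addr0 !mul1r => cF_gt0.
  exact: cF_gt0.
have lt_xh z : z < z + h by rewrite ltrDl.
rewrite walsh_differenceS weightS /= -/(bit _./2); case: (odd S); last first.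
  rewrite add0n mul1r mulrDr => c_gt0 x_gt0.
  by rewrite addr_gt0 ?IH // (lt_trans x_gt0).
rewrite addnCA add1n -addSn => /IH sign_dF x_gt0.
have dD z : 0 < z -> is_derive z 1 (walsh_difference k S./2 (F n))
    (walsh_difference k S./2 (F n.+1) z).
  by apply: is_derive_walsh_difference => t; exact: dF.
have [] := @MVT _ (walsh_difference k S./2 (F n))
  (walsh_difference k S./2 (F n.+1)) _ _ (lt_xh x).
- by move=> z; rewrite in_itv /= => /andP[/(lt_trans x_gt0) /dD].
- apply: derivable_within_continuous => z; rewrite in_itv /= => /andP[xz _].
  by have [] := dD z (lt_le_trans x_gt0 xz).
move=> z; rewrite in_itv /= => /andP[xz _] mvt.
rewrite [ltRHS](_ : _ = h * ((-1) ^+ weight k (bit S./2) * c *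
    walsh_difference k S./2 (F n.+1) z)).
  by rewrite mulr_gt0 // sign_dF // (lt_trans x_gt0).
have {}mvt : walsh_difference k S./2 (F n.+1) z * h =
    walsh_difference k S./2 (F n) (x + h) - walsh_difference k S./2 (F n) x.
  by rewrite mvt addrAC subrr add0r.
by rewrite [RHS]mulrC -[RHS]mulrA mvt expr1 exprS; ring.
Qed.

Definition falling_power p n : R := \prod_(i < n) (p - i%:R).

Lemma is_derive_falling_powR p n z : 0 < z ->
  is_derive z 1 (fun t => falling_power p n * t `^ (p - n%:R))
    (falling_power p n.+1 * z `^ (p - n.+1%:R)).
Proof.
move=> z_gt0; rewrite /falling_power big_ord_recr /= -mulrA -natr1 opprD addrA.
exact/is_deriveZ/is_derive1_powR.
Qed.

Lemma falling_power_neq0 p k n :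
  p \isn't a Num.int \/ k%:R <= p -> (n <= k)%N -> falling_power p n != 0.
Proof.
move=> p_cond le_nk; apply/prodf_neq0 => i _; rewrite subr_eq0.
case: p_cond => [|le_kp]; first by apply: contraNneq => ->; rewrite intr_nat.
by rewrite gt_eqF // (lt_le_trans _ le_kp) // ltr_nat (leq_trans (ltn_ord i)).
Qed.

Lemma walsh_difference_powR_neq0 p k S x :
  p \isn't a Num.int \/ k%:R <= p -> 0 < x ->
  walsh_difference k S (@powR R ^~ p) x != 0.
Proof.
move=> p_cond x_gt0; set s := weight k (bit S).
have s_neq0 : falling_power p s != 0.
  exact: falling_power_neq0 p_cond (weight_leq k _).
have ds_gt0 z : 0 < z ->
    0 < falling_power p s * (falling_power p (0 + s) * z `^ (p - (0 + s)%:R)).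
  by move=> z_gt0; rewrite mulrA -expr2 mulr_gt0 ?powR_gt0 // exprn_even_gt0.
have := walsh_difference_sign (is_derive_falling_powR p) ds_gt0 x_gt0.
have -> : (fun t => falling_power p 0 * t `^ (p - 0%:R)) = @powR R ^~ p.
  by apply/funext => t; rewrite /falling_power big_ord0 mul1r subr0.
by apply: contraTneq => ->; rewrite mulr0 ltxx.
Qed.

End WalshDifference.

Section BumpWeight.
Variables (R : realFieldType) (k : nat) (F : nat -> R).

Local Notation eigenvalue := (walsh_eigenvalue k F).

(* Any computable bound of [\sum_S `|(eigenvalue S)^-1|] would do. *)
Definition inv_eigenvalue_bound : R :=
  1 + \sum_(S < 2 ^ k) (1 + (eigenvalue S)^-1 ^+ 2).

Definition bump_weight (v : nat) : R :=
  (inv_eigenvalue_bound + \sum_(S < 2 ^ k) walsh k S (bit v) / eigenvalue S) /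
  (eigenvalue 0 * inv_eigenvalue_bound).

Hypothesis eigenvalue_neq0 : forall S, eigenvalue S != 0.
Hypothesis eigenvalue0_gt0 : 0 < eigenvalue 0.

Lemma bump_scale_gt0 : 0 < eigenvalue 0 * inv_eigenvalue_bound.
Proof.
rewrite mulr_gt0 // ltr_pwDl // sumr_ge0 // => S _.
by rewrite addr_ge0 ?sqr_ge0.
Qed.

Lemma bump_weight_gt0 v : 0 < bump_weight v.
Proof.
rewrite divr_gt0 ?bump_scale_gt0 // -addrA ltr_pwDl // -big_split /=.
apply: sumr_ge0 => S _; rewrite /walsh -signr_odd.
by case: (odd _); rewrite ?expr0 ?expr1; nra.
Qed.

Lemma sum_bump_weight y :
  \sum_(v < 2 ^ k) bump_weight v * F (hamming k y (bit v)) =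
  1 + (2 ^ k * (weight k y == 0))%:R / (eigenvalue 0 * inv_eigenvalue_bound).
Proof.
set B := inv_eigenvalue_bound; set D := eigenvalue 0 * B.
pose walsh_sum v := \sum_(S < 2 ^ k) walsh k S (bit v) / eigenvalue S.
have D_neq0 : D != 0 := lt0r_neq0 bump_scale_gt0.
have sumF : \sum_(v < 2 ^ k) F (hamming k y (bit v)) = eigenvalue 0.
  rewrite -[RHS]mul1r -(walsh0l _ k y) -sum_walsh_hamming.
  by apply: eq_bigr => v _; rewrite walsh0l mul1r.
have sum_walshF : \sum_(v < 2 ^ k) walsh_sum v * F (hamming k y (bit v)) =
    (2 ^ k * (weight k y == 0))%:R.
  rewrite -sum_walsh; under eq_bigr => v _ do rewrite mulr_suml.
  rewrite exchange_big /=; apply: eq_bigr => S _.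
  rewrite -[RHS](mulfK (eigenvalue_neq0 S)) -sum_walsh_hamming mulr_suml.
  by apply: eq_bigr => v _; rewrite mulrAC.
transitivity ((B * \sum_(v < 2 ^ k) F (hamming k y (bit v)) +
    \sum_(v < 2 ^ k) walsh_sum v * F (hamming k y (bit v))) / D).
  rewrite mulr_sumr -big_split mulr_suml /=; apply: eq_bigr => v _.
  by rewrite /bump_weight -/B -/D mulrAC mulrDl.
by rewrite sumF sum_walshF mulrDl [B * _]mulrC divff.
Qed.

End BumpWeight.

(** * The isolating parallelepiped *)

Section CubeParallelepiped.
Variables (R : realType) (p : R) (k : nat) (c : nat -> R).

Definition cube_entry (v j : nat) : R :=
  (if (j < k)%N then 2 * (-1) ^+ bit v j
   else - (1 + 2 * (weight k (bit v))%:R)) * c v `^ p^-1.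

Definition cube_parallelepiped : 'M[R]_(2 ^ k, k) :=
  \matrix_(v, j) cube_entry v j.

Definition cube_target : 'cV[R]_(2 ^ k) := \col_v cube_entry v k.

Lemma row_mx_cube_entry v (j : 'I_(k + 1)) :
  row_mx cube_parallelepiped cube_target v j = cube_entry v j.
Proof. by rewrite mxE; case: splitP => l jl; rewrite mxE jl // ord1 addn0. Qed.

Lemma cube_parallelepiped_mul (x : 'cV[R]_k) (y : nat -> bool) v :
  (forall j : 'I_k, x j 0 = (y j)%:R) ->
  (cube_parallelepiped *m x - cube_target) v 0 =
  (1 + 2 * (hamming k y (bit v))%:R) * c v `^ p^-1.
Proof.
move=> xy; rewrite !mxE /cube_entry ltnn mulNr opprK.
under eq_bigr => j _ do rewrite mxE xy /cube_entry ltn_ord mulrAC.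
rewrite -mulr_suml -mulrDl; congr (_ * _); rewrite addrCA; congr (1 + _).
rewrite /hamming /weight !natr_sum !mulr_sumr -big_split /=.
by apply: eq_bigr => j _; case: (y j); case: (bit v j) => /=; ring.
Qed.

Hypothesis p_gt0 : 0 < p.
Hypothesis c_ge0 : forall v, 0 <= c v.

Lemma lpnorm_cube_parallelepiped (x : 'cV[R]_k) (y : nat -> bool) :
  (forall j : 'I_k, x j 0 = (y j)%:R) ->
  lpnorm p (cube_parallelepiped *m x - cube_target) =
  (\sum_(v < 2 ^ k) c v * (1 + 2 * (hamming k y (bit v))%:R) `^ p) `^ p^-1.
Proof.
move=> xy; congr (_ `^ _); apply: eq_bigr => v _.
set d := (hamming k y (bit v))%:R.
have d_ge0 : 0 <= 1 + 2 * d by rewrite addr_ge0 ?mulr_ge0.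
rewrite (cube_parallelepiped_mul _ xy) ger0_norm ?mulr_ge0 ?powR_ge0 //.
by rewrite powRM ?powR_ge0 // -powRrM mulVf ?gt_eqF // powRr1 // mulrC.
Qed.

Lemma isolating_cube_parallelepiped (b : R) : 0 < b ->
  (forall y, \sum_(v < 2 ^ k) c v * (1 + 2 * (hamming k y (bit v))%:R) `^ p =
             1 + b * (weight k y == 0)%:R) ->
  isolating_parallelepiped p cube_parallelepiped cube_target.
Proof.
move=> b_gt0 sum_c; split=> [x x01 x_neq0|].
  pose y n := oapp (fun j : 'I_k => x j 0 == 1) false (insub n).
  have xy (j : 'I_k) : x j 0 = (y j)%:R.
    rewrite /y valK /=; case: (x01 j) => ->; rewrite ?eqxx //.
    by rewrite eq_sym oner_eq0.
  rewrite (lpnorm_cube_parallelepiped xy) sum_c weight_eq0.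
  have -> : [forall j : 'I_k, ~~ y j] = false.
    apply: contraNF x_neq0 => /forallP y0.
    by apply/eqP/matrixP => j l; rewrite ord1 xy (negbTE (y0 j)) mxE.
  by rewrite mulr0 addr0 powR1.
have x0 (j : 'I_k) : (0 : 'cV[R]_k) j 0 = false%:R by rewrite mxE.
have -> : lpnorm p cube_target =
    lpnorm p (cube_parallelepiped *m 0 - cube_target).
  rewrite mulmx0 sub0r /lpnorm; congr (_ `^ _).
  by apply: eq_bigr => v _; rewrite !mxE normrN.
have w0 : weight k (fun=> false) = 0%N by rewrite /weight big1.
rewrite (lpnorm_cube_parallelepiped (y := fun=> false) x0) sum_c w0 mulr1.
have := @gt0_ltr_powR _ p^-1 _ 1 (1 + b).
by rewrite powR1; apply; rewrite ?invr_gt0 ?nnegrE ?ltrDl // addr_ge0 // ltW.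
Qed.

End CubeParallelepiped.

Section PowerKernel.
Variables (R : realType) (p : R) (k : nat).
Implicit Types (S v : nat).

Definition odd_powR (d : nat) : R := (1 + 2 * d%:R) `^ p.

Definition power_weight : nat -> R := bump_weight k odd_powR.

Definition power_entry : nat -> nat -> R := cube_entry p k power_weight.

Definition power_parallelepiped : 'M[R]_(2 ^ k, k) :=
  cube_parallelepiped p k power_weight.

Definition power_target : 'cV[R]_(2 ^ k) := cube_target p k power_weight.

Hypothesis p_gt0 : 0 < p.
Hypothesis p_cond : p \isn't a Num.int \/ k%:R <= p.

Lemma odd_powR_eigenvalue_neq0 S : walsh_eigenvalue k odd_powR S != 0.
Proof. exact: walsh_difference_powR_neq0. Qed.

Lemma odd_powR_eigenvalue0_gt0 : 0 < walsh_eigenvalue k odd_powR 0.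
Proof.
rewrite lt_neqAle eq_sym odd_powR_eigenvalue_neq0; apply: sumr_ge0 => v _.
by rewrite walsh0l mul1r powR_ge0.
Qed.

Lemma power_weight_gt0 v : 0 < power_weight v.
Proof. exact/bump_weight_gt0/odd_powR_eigenvalue0_gt0. Qed.

Lemma isolating_power_parallelepiped :
  isolating_parallelepiped p power_parallelepiped power_target.
Proof.
pose b := walsh_eigenvalue k odd_powR 0 * inv_eigenvalue_bound k odd_powR.
have b_gt0 : 0 < b := bump_scale_gt0 odd_powR_eigenvalue0_gt0.
apply: (isolating_cube_parallelepiped p_gt0 _ (b := (2 ^ k)%:R / b)) => [v||y].
- exact/ltW/power_weight_gt0.
- by rewrite divr_gt0 // ltr0n expn_gt0.
rewrite (sum_bump_weight odd_powR_eigenvalue_neq0 odd_powR_eigenvalue0_gt0).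
by rewrite natrM mulrAC.
Qed.

End PowerKernel.

(** * Oracle computability on the naturals *)

(* The inputs of a uniform algorithm: a program computing a function of
   [x : D] is run on the arguments [args x] with the oracle [oracle x], and
   must work for all [x].  Binding a variable replaces [D] by [D * nat]. *)
Record domain := Domain {
  point :> Type;
  oracle : point -> nat -> nat;
  args : point -> seq nat;
  arity : nat;
  size_args : forall x, size (args x) = arity
}.

Section ExtendedDomain.
Variable D : domain.

Let cons_args (x : D * nat) : seq nat := x.2 :: args x.1.

Let size_cons_args x : size (cons_args x) = (arity D).+1.
Proof. by rewrite /= size_args. Qed.

Canonical extended_domain : domain :=
  Domain (fun x => oracle x.1) size_cons_args.

End ExtendedDomain.

Definition nat_computable (D : domain) (f : D -> nat) : Prop :=
  exists c : prog, forall x, Defs.eval (oracle x) c (args x) (f x).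

Definition computable_map (D D' : domain) (s : D -> D') : Prop :=
  (forall x, oracle (s x) = oracle x) /\
  exists cs : seq prog, forall x, evals (oracle x) cs (args x) (args (s x)).

Section NatComputable.
Local Open Scope nat_scope.
Implicit Types (D : domain).

Lemma eq_nat_computable D (f g : D -> nat) :
  f =1 g -> nat_computable f -> nat_computable g.
Proof. by move=> fg [c hc]; exists c => x; rewrite -fg. Qed.

Lemma nat_computable_comp D D' (f : D' -> nat) (s : D -> D') :
  nat_computable f -> computable_map s -> nat_computable (fun x => f (s x)).
Proof.
move=> [c hc] [oracle_s [cs hcs]]; exists (PComp c cs) => x.
by apply: EvalComp (hcs x) _; rewrite -oracle_s.
Qed.

Lemma nat_computable_arg D i : nat_computable (fun x : D => nth 0 (args x) i).
Proof. by exists (PProj i) => x; apply: EvalProj. Qed.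

Lemma evals_proj phi (s js : seq nat) :
  evals phi [seq PProj j | j <- js] s [seq nth 0 s j | j <- js].
Proof.
elim: js => [|j js IH]; first exact: EvalNil.
by apply: EvalCons IH; apply: EvalProj.
Qed.

Definition proj_args (D : domain) : seq prog :=
  [seq PProj i | i <- iota 0 (arity D)].

Lemma evals_proj_args D (x : D) :
  evals (oracle x) (proj_args D) (args x) (args x).
Proof.
rewrite /proj_args -(size_args x) -[X in evals _ _ _ X]take_size.
by rewrite -(map_nth_iota0 0) //; apply: evals_proj.
Qed.

Lemma computable_map_id D : computable_map (fun x : D => x).
Proof. by split=> //; exists (proj_args D) => x; apply: evals_proj_args. Qed.

Lemma computable_map_pair D D' (s : D -> D') (f : D -> nat) :
  computable_map s -> nat_computable f -> computable_map (fun x => (s x, f x)).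
Proof.
move=> [oracle_s [cs hcs]] [c hc]; split=> //.
by exists (c :: cs) => x; apply: EvalCons.
Qed.

Lemma computable_map_fst D D' (s : D -> D' * nat) :
  computable_map s -> computable_map (fun x => (s x).1).
Proof.
move=> [oracle_s [cs hcs]]; split=> //; exists (behead cs) => x.
by have := hcs x => /= evals_s; inversion evals_s.
Qed.

Lemma evals_comp phi cs ds s ys zs :
  evals phi cs s ys -> evals phi ds ys zs ->
  evals phi [seq PComp d cs | d <- ds] s zs.
Proof.
move=> hcs; elim: ds zs => [|d ds IH] zs hds; inversion hds; subst.
  exact: EvalNil.
by apply: EvalCons; [apply: EvalComp hcs _ | apply: IH].
Qed.

Lemma computable_map_comp D D' D'' (t : D' -> D'') (s : D -> D') :
  computable_map t -> computable_map s -> computable_map (fun x => t (s x)).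
Proof.
move=> [oracle_t [ds hds]] [oracle_s [cs hcs]]; split=> [x|].
  by rewrite oracle_t.
exists [seq PComp d cs | d <- ds] => x.
by apply: evals_comp (hcs x) _; rewrite -oracle_s.
Qed.

Lemma nat_computable_snd D D' (s : D -> D' * nat) :
  computable_map s -> nat_computable (fun x => (s x).2).
Proof. exact: (nat_computable_comp (nat_computable_arg _ 0)). Qed.

Lemma nat_computable_succ D (f : D -> nat) :
  nat_computable f -> nat_computable (fun x => (f x).+1).
Proof.
move=> [c hc]; exists (PComp PSucc [:: c]) => x.
by apply: EvalComp (EvalSucc _ [:: f x]); apply: EvalCons (EvalNil _ _).
Qed.

Lemma nat_computable_const D m : nat_computable (fun _ : D => m).
Proof.
elim: m => [|m IH]; last exact: nat_computable_succ.
by exists PZero => x; apply: EvalZero.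
Qed.

Lemma nat_computable_oracle D (f : D -> nat) :
  nat_computable f -> nat_computable (fun x => oracle x (f x)).
Proof.
move=> [c hc]; exists (PComp POracle [:: c]) => x.
by apply: EvalComp (EvalOracle _ [:: f x]); apply: EvalCons (EvalNil _ _).
Qed.

Lemma nat_computable_rec D (f N : D -> nat) (g : D * nat * nat -> nat) :
  nat_computable f -> nat_computable g -> nat_computable N ->
  nat_computable (fun x => iteri (N x) (fun i r => g (x, r, i)) (f x)).
Proof.
move=> [c hc] [d hd] [b hb]; exists (PComp (PRec c d) (b :: proj_args D)) => x.
apply: EvalComp; first exact: EvalCons (hb x) (evals_proj_args x).
elim: (N x) => [|m IH] /=; first exact: EvalRec0.
exact: EvalRecS IH (hd (x, _, m)).
Qed.

Lemma nat_computable_iter D (f N : D -> nat) (g : D * nat -> nat) :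
  nat_computable f -> nat_computable g -> nat_computable N ->
  nat_computable (fun x => iter (N x) (fun r => g (x, r)) (f x)).
Proof.
move=> hf hg hN; have hg1 : nat_computable (fun z : D * nat * nat => g z.1).
  exact: nat_computable_comp hg (computable_map_fst (computable_map_id _)).
apply: eq_nat_computable (nat_computable_rec hf hg1 hN) => x.
by elim: (N x) => //= m ->.
Qed.

End NatComputable.

Ltac computability_rule := fail.

Ltac computability :=
  repeat first
    [ assumption | exact: nat_computable_const | exact: computable_map_id
    | apply: computable_map_fst | apply: computable_map_pair
    | apply: nat_computable_snd | apply: nat_computable_succ
    | computability_rule
    | match goal with
        H : nat_computable ?f |- nat_computable (fun x => ?f (@?s x)) =>
          apply: (nat_computable_comp (s := s) H)
      | H : nat_computable (fun z => nat_of_bool (?P z))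
          |- nat_computable (fun x => nat_of_bool (?P (@?s x))) =>
          apply: (nat_computable_comp (s := s) H)
      | H : computable_map ?t |- computable_map (fun x => ?t (@?s x)) =>
          apply: (computable_map_comp (s := s) H)
      end ].

Section NatArithmetic.
Local Open Scope nat_scope.
Implicit Types (D : domain).

Lemma nat_computable_add D (f g : D -> nat) :
  nat_computable f -> nat_computable g -> nat_computable (fun x => f x + g x).
Proof.
move=> hf hg.
apply: eq_nat_computable
  (nat_computable_iter (g := fun z => z.2.+1) hf _ hg) => [x|].
  exact: iter_succn.
by computability.
Qed.

Lemma nat_computable_mul D (f g : D -> nat) :
  nat_computable f -> nat_computable g -> nat_computable (fun x => f x * g x).
Proof.
move=> hf hg; have h0 := nat_computable_const D 0.
apply: eq_nat_computable
  (nat_computable_iter (g := fun z => f z.1 + z.2) h0 _ hg) => [x|].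
  by rewrite -iter_addn_0.
by apply: nat_computable_add; computability.
Qed.

Lemma nat_computable_exp D (f g : D -> nat) :
  nat_computable f -> nat_computable g -> nat_computable (fun x => f x ^ g x).
Proof.
move=> hf hg; have h1 := nat_computable_const D 1.
apply: eq_nat_computable
  (nat_computable_iter (g := fun z => f z.1 * z.2) h1 _ hg) => [x|].
  by rewrite -[RHS]muln1 -iter_muln.
by apply: nat_computable_mul; computability.
Qed.

Lemma nat_computable_pred D (f : D -> nat) :
  nat_computable f -> nat_computable (fun x => (f x).-1).
Proof.
move=> hf; apply: eq_nat_computable
  (nat_computable_rec (g := fun z => z.2) (nat_computable_const D 0) _ hf).
  by move=> x; case: (f x).
by computability.
Qed.

Lemma nat_computable_sub D (f g : D -> nat) :
  nat_computable f -> nat_computable g -> nat_computable (fun x => f x - g x).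
Proof.
move=> hf hg.
apply: eq_nat_computable
  (nat_computable_iter (g := fun z => z.2.-1) hf _ hg) => [x|].
  exact: iter_predn.
by apply: nat_computable_pred; computability.
Qed.

Lemma nat_computable_leq D (f g : D -> nat) :
  nat_computable f -> nat_computable g -> nat_computable (fun x => f x <= g x).
Proof.
move=> hf hg; have h1 := nat_computable_const D 1.
apply: eq_nat_computable
  (nat_computable_sub h1 (nat_computable_sub hf hg)) => x.
by rewrite -[_ <= _]subn_eq0; case: (_ - g x).
Qed.

Lemma nat_computable_neg D (P : D -> bool) :
  nat_computable (fun x => P x) -> nat_computable (fun x => ~~ P x).
Proof.
move=> hP; have h1 := nat_computable_const D 1.
by apply: eq_nat_computable (nat_computable_sub h1 hP) => x; case: (P x).
Qed.

Lemma nat_computable_and D (P Q : D -> bool) :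
  nat_computable (fun x => P x) -> nat_computable (fun x => Q x) ->
  nat_computable (fun x => P x && Q x).
Proof.
move=> hP hQ; apply: eq_nat_computable (nat_computable_mul hP hQ) => x.
exact: mulnb.
Qed.

Lemma nat_computable_sum D (f : D * nat -> nat) (N : D -> nat) :
  nat_computable f -> nat_computable N ->
  nat_computable (fun x => \sum_(i < N x) f (x, val i)).
Proof.
move=> hf hN; have h0 := nat_computable_const D 0.
apply: eq_nat_computable (nat_computable_rec
    (g := fun z => z.1.2 + f (z.1.1, z.2)) h0 _ hN) => [x|].
  by elim: (N x) => [|n IH]; rewrite ?big_ord0 // big_ord_recr /= IH.
by apply: nat_computable_add; computability.
Qed.

Lemma nat_computable_exists D (P : D * nat -> bool) (N : D -> nat) :
  nat_computable (fun z => P z) -> nat_computable N ->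
  nat_computable (fun x => [exists i : 'I_(N x), P (x, val i)]).
Proof.
move=> hP hN; have h1 := nat_computable_const D 1.
apply: eq_nat_computable
  (nat_computable_leq h1 (nat_computable_sum hP hN)) => x.
rewrite lt0n sum_nat_eq0 negb_forall; congr (nat_of_bool _).
by apply: eq_existsb => i /=; rewrite eqb0 negbK.
Qed.

Lemma divn_count m d : 0 < d -> m %/ d = \sum_(i < m) (i.+1 * d <= m).
Proof.
move=> d_gt0; under eq_bigr => i _ do rewrite -leq_divRL //.
elim: m (m %/ d) (leq_div m d) => [|m IH] [|q] // le_qm.
- by rewrite big_ord0.
- by rewrite big1.
- by rewrite big_ord_recl /= -IH.
Qed.

Lemma nat_computable_div D (f g : D -> nat) :
  nat_computable f -> nat_computable g -> nat_computable (fun x => f x %/ g x).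
Proof.
move=> hf hg; have h1 := nat_computable_const D 1.
apply: eq_nat_computable (nat_computable_mul (nat_computable_leq h1 hg)
  (nat_computable_sum (f := fun z => z.2.+1 * g z.1 <= f z.1) _ hf)) => [x|] /=.
  by have [->|d_gt0] := posnP (g x); rewrite ?divn0 // mul1n divn_count.
by apply: nat_computable_leq; first apply: nat_computable_mul; computability.
Qed.

Lemma nat_computable_odd D (f : D -> nat) :
  nat_computable f -> nat_computable (fun x => odd (f x)).
Proof.
move=> hf; have h2 := nat_computable_const D 2.
have h2f := nat_computable_mul (nat_computable_div hf h2) h2.
apply: eq_nat_computable (nat_computable_sub hf h2f) => x.
by rewrite -modn2 {1}(divn_eq (f x) 2) addKn.
Qed.

Lemma nat_computable_mu D (P : D * nat -> bool) :
  nat_computable (fun z => P z) -> (forall x, exists n, P (x, n)) ->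
  exists2 g, nat_computable g & forall x, P (x, g x).
Proof.
move=> hP exP.
exists (fun x => ex_minn (exP x)); last by move=> x; case: ex_minnP.
have [c hc] := nat_computable_sub (nat_computable_const _ 1) hP.
exists (PMu c) => x; case: ex_minnP => n Pn min_n.
apply: (@EvalMu _ _ _ _ (fun=> 0)) => [m lt_mn|].
  have := hc (x, m); rewrite (_ : P (x, m) = false) //.
  by apply: contraTF lt_mn => /min_n; rewrite leqNgt.
by have := hc (x, n); rewrite Pn.
Qed.

End NatArithmetic.

Ltac computability_rule ::=
  first
    [ apply: nat_computable_exp | apply: nat_computable_mul
    | apply: nat_computable_add | apply: nat_computable_sub
    | apply: nat_computable_div | apply: nat_computable_leq
    | apply: nat_computable_and | apply: nat_computable_neg
    | apply: nat_computable_odd | apply: nat_computable_pred ].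

(** * Computability of integers and reals *)

Definition int_computable (D : domain) (F : D -> int) : Prop :=
  exists a b : D -> nat,
    [/\ nat_computable a, nat_computable b &
        forall x, F x = (a x)%:Z - (b x)%:Z].

Section IntComputable.
Implicit Types (D : domain).

Lemma int_computable_comp D D' (F : D' -> int) (s : D -> D') :
  int_computable F -> computable_map s -> int_computable (fun x => F (s x)).
Proof.
move=> [a [b [ha hb FE]]] hs; exists (a \o s), (b \o s).
by split; [exact: nat_computable_comp hs | exact: nat_computable_comp hs |].
Qed.

Lemma int_computable_nat D (f : D -> nat) :
  nat_computable f -> int_computable (fun x => (f x)%:Z).
Proof.
move=> hf; exists f, (fun=> 0%N); split=> // [|x]; last by rewrite subr0.
exact: nat_computable_const.
Qed.

Lemma int_computable_opp D (F : D -> int) :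
  int_computable F -> int_computable (fun x => - F x).
Proof.
by move=> [a [b [ha hb FE]]]; exists b, a; split=> // x; rewrite FE opprB.
Qed.

Lemma int_computable_add D (F G : D -> int) :
  int_computable F -> int_computable G -> int_computable (fun x => F x + G x).
Proof.
move=> [a [b [ha hb FE]]] [c [d [hc hd GE]]].
exists (fun x => a x + c x)%N, (fun x => b x + d x)%N.
by split; [computability..|] => x; rewrite FE GE !PoszD; ring.
Qed.

Lemma int_computable_mul D (F G : D -> int) :
  int_computable F -> int_computable G -> int_computable (fun x => F x * G x).
Proof.
move=> [a [b [ha hb FE]]] [c [d [hc hd GE]]].
exists (fun x => a x * c x + b x * d x)%N, (fun x => a x * d x + b x * c x)%N.
by split; [computability..|] => x; rewrite FE GE !PoszD !PoszM; ring.
Qed.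

Lemma int_computable_sum D (F : D * nat -> int) (N : D -> nat) :
  int_computable F -> nat_computable N ->
  int_computable (fun x => \sum_(i < N x) F (x, val i)).
Proof.
move=> [a [b [ha hb FE]]] hN.
exists (fun x => \sum_(i < N x) a (x, val i))%N.
exists (fun x => \sum_(i < N x) b (x, val i))%N.
split; [exact: nat_computable_sum.. | move=> x].
by rewrite -!natz !natr_sum -sumrB; apply: eq_bigr => i _; rewrite FE !natz.
Qed.

Lemma int_computable_div D (F : D -> int) (d : D -> nat) :
  int_computable F -> nat_computable d -> (forall x, 0 < d x)%N ->
  int_computable (fun x => (F x %/ (d x)%:Z)%Z).
Proof.
move=> [a [b [ha hb FE]]] hd d_gt0.
exists (fun x => (a x + (d x).-1 * b x) %/ d x)%N, b.
split=> // [|x]; first by computability.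
rewrite -divz_nat; have -> : F x = - (b x)%:Z * d x + (a x + (d x).-1 * b x)%:Z.
  by rewrite FE PoszD PoszM predn_int //; ring.
have d_neq0 : (d x)%:Z != 0 by rewrite -lt0n d_gt0.
by rewrite (divzMDl _ _ d_neq0) addrC.
Qed.

Lemma int_computable_le D (F G : D -> int) :
  int_computable F -> int_computable G -> nat_computable (fun x => F x <= G x).
Proof.
move=> [a [b [ha hb FE]]] [c [d [hc hd GE]]].
apply: (@eq_nat_computable _ (fun x => a x + d x <= c x + b x)%N) => [x|].
  by rewrite FE GE lerBlDr addrAC lerBrDr -!PoszD lez_nat.
by computability.
Qed.

Lemma int_of_codeE m :
  int_of_code m = (~~ odd m * (m %/ 2))%:Z - (odd m * (m %/ 2).+1)%:Z.
Proof.
rewrite /int_of_code divn2; case: (odd m); rewrite ?mul0n ?mul1n ?subr0 //.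
by rewrite sub0r NegzE.
Qed.

Lemma int_of_code_sub a b :
  int_of_code (2 * (a - b) + (2 * (b - a)).-1) = a%:Z - b%:Z.
Proof.
have [le_ba|lt_ab] := leqP b a.
  have /eqP -> : (b - a == 0)%N by rewrite subn_eq0.
  by rewrite /int_of_code muln0 addn0 mul2n odd_double doubleK subzn.
have /eqP -> : (a - b == 0)%N by rewrite subn_eq0 ltnW.
rewrite -[RHS]opprB subzn; last exact: ltnW.
have [d ->] : exists d, (b - a)%N = d.+1.
  by exists (b - a).-1; rewrite prednK ?subn_gt0.
rewrite /int_of_code muln0 add0n mulnS /= mul2n odd_double /= uphalf_double.
by rewrite NegzE.
Qed.

Lemma int_computable_of_code D (f : D -> nat) :
  nat_computable f -> int_computable (fun x => int_of_code (f x)).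
Proof.
move=> hf; exists (fun x => ~~ odd (f x) * (f x %/ 2))%N.
exists (fun x => odd (f x) * (f x %/ 2).+1)%N.
by split; [computability..|] => x; rewrite int_of_codeE.
Qed.

Lemma int_computable_code D (F : D -> int) : int_computable F ->
  exists2 f : D -> nat, nat_computable f & forall x, int_of_code (f x) = F x.
Proof.
move=> [a [b [ha hb FE]]].
exists (fun x => 2 * (a x - b x) + (2 * (b x - a x)).-1)%N => [|x].
  by computability.
by rewrite int_of_code_sub FE.
Qed.

Lemma int_computable_norm_le D (F : D -> int) : int_computable F ->
  exists2 B : D -> nat, nat_computable B & forall x, `|F x| <= (B x)%:Z.
Proof.
move=> [a [b [ha hb FE]]]; exists (fun x => a x + b x)%N => [|x].
  by computability.
by rewrite FE PoszD (le_trans (ler_normB _ _)) // !ger0_norm.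
Qed.

End IntComputable.

Ltac int_computability :=
  repeat first
    [ apply: int_computable_nat | apply: int_computable_add
    | apply: int_computable_opp | apply: int_computable_mul
    | match goal with
        H : int_computable ?F |- int_computable (fun x => ?F (@?s x)) =>
          apply: (int_computable_comp (s := s) H)
      end
    | progress computability ].

Lemma divz_nearest (R : realFieldType) (N : int) (d : nat) : (0 < d)%N ->
  `|((2%:Z * N + d%:Z) %/ (2 * d)%:Z)%Z%:~R - N%:~R / d%:R| <= 2^-1 :> R.
Proof.
move=> d_gt0; have d2_gt0 : 0 < (2 * d)%:Z by rewrite ltz_nat muln_gt0.
have dR_gt0 : 0 < d%:R :> R by rewrite ltr0n.
have := lez_floor (2%:Z * N + d) (lt0r_neq0 d2_gt0).
have := ltz_ceil (2%:Z * N + d) d2_gt0; set q := (_ %/ _)%Z.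
rewrite -(ltr_int R) -(ler_int R) !(intrD, intrM) -!pmulrn natrM.
set r := N%:~R / d%:R; have -> : N%:~R = r * d%:R by rewrite divfK ?gt_eqF.
have -> : 2 * (r * d%:R) + d%:R = (2 * r + 1) * d%:R by ring.
rewrite !(mulrA _ 2) ltr_pM2r // ler_pM2r // ler_norml => lt_rq le_qr.
by apply/andP; split; lra.
Qed.

Lemma distr_mul_le (R : numDomainType) (x y u v e : R) : e <= 1 ->
  `|u - x| <= e -> `|v - y| <= e -> `|u * v - x * y| <= e * (`|x| + `|y| + 1).
Proof.
move=> e_le1 hu hv.
have -> : u * v - x * y =
  (u - x) * (v - y) + (x * (v - y) + y * (u - x)) by ring.
have prod_le : `|(u - x) * (v - y)| <= e.
  by rewrite normrM -[leRHS]mulr1 ler_pM // (le_trans hv).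
have x_le : `|x * (v - y)| <= e * `|x| by rewrite normrM mulrC ler_wpM2r.
have y_le : `|y * (u - x)| <= e * `|y| by rewrite normrM mulrC ler_wpM2r.
rewrite [leRHS]mulrDr mulr1 [leRHS]addrC [e * _]mulrDr.
rewrite (le_trans (ler_normD _ _)) // lerD //.
by rewrite (le_trans (ler_normD _ _)) // lerD.
Qed.

Lemma natr_le_exp2 (R : numDomainType) (n : nat) : n%:R <= 2 ^+ n :> R.
Proof. by rewrite -natrX ler_nat ltnW // ltn_expl. Qed.

Definition real_computable (R : realType) (D : domain) (X : D -> R) : Prop :=
  exists2 F : D * nat -> int, int_computable F &
    forall x m, `|(F (x, m))%:~R / 2 ^+ m - X x| <= 2 ^- m.

Section RealComputable.
Variable R : realType.
Implicit Types (D : domain).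

Let exp2_gt0 m : 0 < 2 ^+ m :> R. Proof. by rewrite exprn_gt0. Qed.

Let exp2_neq0 m : 2 ^+ m != 0 :> R. Proof. exact/lt0r_neq0/exp2_gt0. Qed.

Lemma eq_real_computable D (X Y : D -> R) :
  X =1 Y -> real_computable X -> real_computable Y.
Proof. by move=> XY [F hF FX]; exists F => // x m; rewrite -XY. Qed.

Lemma real_computable_comp D D' (X : D' -> R) (s : D -> D') :
  real_computable X -> computable_map s -> real_computable (fun x => X (s x)).
Proof.
move=> [F hF FX] hs; exists (fun z => F (s z.1, z.2)) => [|x m]; last exact: FX.
by apply: (int_computable_comp (s := fun z => (s z.1, z.2)) hF); computability.
Qed.

Lemma real_computable_of_rat D (X : D -> R) (F : D * nat -> int)
    (d : D * nat -> nat) :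
  int_computable F -> nat_computable d -> (forall z, 0 < d z)%N ->
  (forall x m, `|(F (x, m))%:~R / (d (x, m))%:R - X x| <= 2 ^- m.+1) ->
  real_computable X.
Proof.
move=> hF hd d_gt0 approxX.
pose N z := (2 ^ z.2)%N%:Z * F z.
exists (fun z => ((2%:Z * N z + (d z)%:Z) %/ (2 * d z)%:Z)%Z) => [|x m].
  apply: int_computable_div => [||z]; rewrite ?muln_gt0 ?d_gt0 //.
    by rewrite /N; int_computability.
  by computability.
set q := (_ %/ _)%Z; have M_gt0 : 0 < 2 ^- m :> R by rewrite invr_gt0.
have q_approx : `|q%:~R / 2 ^+ m - (F (x, m))%:~R / (d (x, m))%:R| <=
    2^-1 * 2 ^- m :> R.
  have -> : (F (x, m))%:~R / (d (x, m))%:R =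
      (N (x, m))%:~R / (d (x, m))%:R / 2 ^+ m :> R.
    rewrite intrM -pmulrn natrX [2 ^+ m * _]mulrC.
    by rewrite [_ * _ / (d _)%:R]mulrAC mulfK.
  by rewrite -mulrBl normrM (gtr0_norm M_gt0) ler_pM2r // divz_nearest.
apply: le_trans (ler_distD ((F (x, m))%:~R / (d (x, m))%:R) _ _) _.
by have := approxX x m; rewrite exprS invfM; lra.
Qed.

Lemma real_computable_nat D (f : D -> nat) :
  nat_computable f -> real_computable (fun x => (f x)%:R : R).
Proof.
move=> hf; exists (fun z => (2 ^ z.2 * f z.1)%N%:Z) => [|x m].
  by int_computability.
rewrite -pmulrn natrM natrX [2 ^+ m * _]mulrC mulfK //.
by rewrite subrr normr0 invr_ge0 ltW.
Qed.

Lemma real_computable_const D (m : nat) :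
  real_computable (fun _ : D => m%:R : R).
Proof. by apply: (real_computable_nat (f := fun=> m)); computability. Qed.

Lemma real_computable_opp D (X : D -> R) :
  real_computable X -> real_computable (fun x => - X x).
Proof.
move=> [F hF FX]; exists (fun z => - F z) => [|x m]; first by int_computability.
by rewrite mulrNz mulNr -opprD normrN.
Qed.

Lemma real_computable_add D (X Y : D -> R) :
  real_computable X -> real_computable Y ->
  real_computable (fun x => X x + Y x).
Proof.
move=> [F hF FX] [G hG GY].
apply: (real_computable_of_rat
  (F := fun z => F (z.1, z.2.+2) + G (z.1, z.2.+2))
  (d := fun z => (2 ^ z.2.+2)%N)) => [|||x m] /=.
- by int_computability.
- by computability.
- by move=> z; rewrite expn_gt0.
have := FX x m.+2; have := GY x m.+2; rewrite intrD mulrDl natrX.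
have -> : 2 ^- m.+1 = 2 * 2 ^- m.+2 :> R.
  by rewrite [in RHS]exprS invfM mulVKf ?pnatr_eq0.
move=> hY hX; rewrite opprD addrACA mulr_natl mulr2n.
by rewrite (le_trans (ler_normD _ _)) // lerD.
Qed.

Lemma real_computable_norm_le D (X : D -> R) : real_computable X ->
  exists2 B : D -> nat, nat_computable B & forall x, `|X x| <= (B x)%:R.
Proof.
move=> [F hF FX].
have [|B hB leFB] := int_computable_norm_le (F := fun x => F (x, 0%N)).
  by int_computability.
exists (fun x => (B x).+1) => [|x]; first by computability.
have := FX x 0%N; rewrite expr0 invr1 mulr1.
have := leFB x; rewrite -(ler_int R) intr_norm -pmulrn -natr1 !ler_norml.
by move=> /andP[? ?] /andP[? ?]; apply/andP; split; lra.
Qed.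

Lemma real_computable_mul D (X Y : D -> R) :
  real_computable X -> real_computable Y ->
  real_computable (fun x => X x * Y x).
Proof.
move=> hX hY; have [B hB leXB] := real_computable_norm_le hX.
have [C hC leYC] := real_computable_norm_le hY.
move: hX hY => [F hF FX] [G hG GY].
pose b x := (B x + C x).+1; pose prec z := (z.2.+1 + b z.1)%N.
apply: (real_computable_of_rat
  (F := fun z => F (z.1, prec z) * G (z.1, prec z))
  (d := fun z => (2 ^ prec z * 2 ^ prec z)%N)) => [|||x m] /=.
- by rewrite /prec /b; int_computability.
- by rewrite /prec /b; computability.
- by move=> z; rewrite muln_gt0 expn_gt0.
have e_le1 : 2 ^- prec (x, m) <= 1 :> R.
  by rewrite invf_le1 // exprn_ege1 ?ler1n.
have := distr_mul_le e_le1 (FX x (prec (x, m))) (GY x (prec (x, m))).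
rewrite intrM natrM natrX invfM mulrACA => /le_trans; apply.
have -> : 2 ^- prec (x, m) = 2 ^- m.+1 * 2 ^- b x :> R.
  by rewrite /prec exprD invfM.
rewrite -mulrA ler_piMr ?invr_ge0 ?exprn_ge0 // mulrC ler_pdivrMr // mul1r.
apply: le_trans (natr_le_exp2 R (b x)); rewrite /b -natr1 natrD.
by have := leXB x; have := leYC x; lra.
Qed.

Lemma real_computable_sum D (X : D * nat -> R) (N : D -> nat) :
  real_computable X -> nat_computable N ->
  real_computable (fun x => \sum_(i < N x) X (x, val i)).
Proof.
move=> [F hF FX] hN; pose prec z := (z.2.+1 + N z.1)%N.
apply: (real_computable_of_rat
  (F := fun z => \sum_(i < N z.1) F ((z.1, val i), prec z))
  (d := fun z => (2 ^ prec z)%N)) => [|||x m] /=.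
- apply: (int_computable_sum (F := fun z => F (z.1.1, z.2, prec z.1))).
    by rewrite /prec; int_computability.
  by computability.
- by rewrite /prec; computability.
- by move=> z; rewrite expn_gt0.
rewrite rmorph_sum mulr_suml -sumrB /= natrX.
apply: le_trans (ler_norm_sum _ _ _) _.
apply: (@le_trans _ _ (\sum_(i < N x) 2 ^- prec (x, m))).
  by apply: ler_sum => i _; exact: FX.
rewrite sumr_const card_ord -[_ *+ N x]mulr_natl /prec /= exprD invfM mulrCA.
by rewrite ler_piMr ?invr_ge0 ?exprn_ge0 // ler_pdivrMr // mul1r natr_le_exp2.
Qed.

Lemma real_computable_sign D (f : D -> nat) :
  nat_computable f -> real_computable (fun x => (-1) ^+ f x : R).
Proof.
move=> hf; apply: (@eq_real_computable _
  (fun x => (~~ odd (f x))%:R + - (odd (f x))%:R)).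
  by move=> x; rewrite -signr_odd; case: (odd _); rewrite ?sub0r ?subr0.
by apply: real_computable_add; last apply: real_computable_opp;
  apply: real_computable_nat; computability.
Qed.

Lemma real_computable_if D (P : D -> bool) (X Y : D -> R) :
  nat_computable (fun x => P x) -> real_computable X -> real_computable Y ->
  real_computable (fun x => if P x then X x else Y x).
Proof.
move=> hP hX hY; apply: (@eq_real_computable _
  (fun x => (P x)%:R * X x + (~~ P x)%:R * Y x)).
  by move=> x; case: (P x); rewrite ?mul1r ?mul0r ?addr0 ?add0r.
apply: real_computable_add; apply: real_computable_mul => //;
  by apply: real_computable_nat; computability.
Qed.

End RealComputable.

Ltac real_computability :=
  repeat first
    [ assumption | exact: (real_computable_const _ _ 1)
    | exact: (real_computable_const _ _ 2)
    | apply: real_computable_add | apply: real_computable_opp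
    | apply: real_computable_mul | apply: real_computable_sign
    | apply: real_computable_if | apply: real_computable_nat
    | match goal with
        H : real_computable ?X |- real_computable (fun x => ?X (@?s x)) =>
          apply: (real_computable_comp (s := s) H)
      end
    | progress computability ].

(** * Rational tests for real powers *)

Lemma truncn_pred_itv (R : archiRealDomainType) (x : R) : 0 < x ->
  (Num.truncn x).-1%:R < x < (Num.truncn x).-1.+2%:R.
Proof.
move=> x_gt0; have /andP[] := truncn_itv (ltW x_gt0).
case: (Num.truncn x) => [|n] le_nx lt_xn /=.
  by rewrite x_gt0 (lt_trans lt_xn) // ltr_nat.
by rewrite lt_xn (lt_le_trans _ le_nx) // ltr_nat.
Qed.

Lemma ltr_expM_exists (R : archiRealFieldType) (a b c : R) :
  0 <= a < b -> 0 < c ->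
  exists N, c * a ^+ N < b ^+ N.
Proof.
move=> /andP[a_ge0 lt_ab] c_gt0; have b_gt0 := le_lt_trans a_ge0 lt_ab.
have ab_lt1 : `|a / b| < 1.
  by rewrite ger0_norm ?divr_ge0 ?(ltW b_gt0) // ltr_pdivrMr ?mul1r.
have [N _ /(_ N (leqnn N))] :
    (\forall N \near \oo, (a / b) ^+ N < c^-1)%classic.
  by apply: (cvgr_lt 0); [exact: cvg_expr | rewrite invr_gt0].
rewrite expr_div_n ltr_pdivrMr ?exprn_gt0 // => ltN; exists N.
by rewrite -ltr_pdivlMl.
Qed.

Section PowerTests.
Variable R : realType.

Lemma powR_natM (x y : R) (N : nat) : x `^ (N%:R * y) = (x `^ y) ^+ N.
Proof. by rewrite mulrC powRrM powR_mulrn ?powR_ge0. Qed.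

(* For [v] just below [N * y], the power [x ^+ v] falls short of [x `^ (N * y)]
   by at most the factor [x ^+ 2], which is negligible for large [N]. *)
Lemma lt_powR_ratP (x y c d : R) : 1 <= x -> 0 < y -> 0 <= c -> 0 < d ->
  c / d < x `^ y <->
  exists N v : nat, v%:R < N%:R * y /\ c ^+ N < x ^+ v * d ^+ N.
Proof.
move=> x_ge1 y_gt0 c_ge0 d_gt0; have x_gt0 : 0 < x := lt_le_trans ltr01 x_ge1.
have cd_ge0 : 0 <= c / d by rewrite divr_ge0 // ltW.
have ratE N v : (c ^+ N < x ^+ v * d ^+ N) = ((c / d) ^+ N < x ^+ v).
  by rewrite expr_div_n ltr_pdivrMr ?exprn_gt0.
split=> [lt_cdr | [N [v]]]; last first.
  rewrite ratE => -[lt_vN lt_cdx].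
  have N_gt0 : (0 < N)%N by case: N lt_vN {lt_cdx} => //; rewrite mul0r ltrn0.
  rewrite -(ltr_pXn2r N_gt0) ?nnegrE ?powR_ge0 // (lt_le_trans lt_cdx) //.
  by rewrite -powR_natM -powR_mulrn ?(ltW x_gt0) // ler_powR // ltW.
have [|N lt_cdN] := @ltr_expM_exists R (c / d) (x `^ y) _ _ (exprn_gt0 2 x_gt0).
  by rewrite cd_ge0.
have N_gt0 : (0 < N)%N.
  by case: N lt_cdN => //; rewrite !expr0 mulr1 ltNge exprn_ege1.
have /truncn_pred_itv/andP[lt_vN lt_Nv] : 0 < N%:R * y.
  by rewrite mulr_gt0 ?ltr0n.
exists N, (Num.truncn (N%:R * y)).-1; rewrite ratE; split=> //.
rewrite -(ltr_pM2l (exprn_gt0 2 x_gt0)) (lt_le_trans lt_cdN) // -exprD.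
by rewrite -powR_natM -powR_mulrn ?(ltW x_gt0) // ler_powR // ltW.
Qed.

Lemma powR_lt_ratP (x y c d : R) : 1 <= x -> 0 < y -> 0 <= c -> 0 < d ->
  x `^ y < c / d <->
  exists N v : nat, N%:R * y < v%:R /\ x ^+ v * d ^+ N < c ^+ N.
Proof.
move=> x_ge1 y_gt0 c_ge0 d_gt0; have x_gt0 : 0 < x := lt_le_trans ltr01 x_ge1.
have cd_ge0 : 0 <= c / d by rewrite divr_ge0 // ltW.
have ratE N v : (x ^+ v * d ^+ N < c ^+ N) = (x ^+ v < (c / d) ^+ N).
  by rewrite expr_div_n ltr_pdivlMr ?exprn_gt0.
split=> [lt_rcd | [N [v]]]; last first.
  rewrite ratE => -[lt_Nv lt_xcd].
  have N_gt0 : (0 < N)%N.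
    by case: N lt_xcd {lt_Nv} => //; rewrite expr0 ltNge exprn_ege1.
  rewrite -(ltr_pXn2r N_gt0) ?nnegrE ?powR_ge0 // (le_lt_trans _ lt_xcd) //.
  by rewrite -powR_natM -powR_mulrn ?(ltW x_gt0) // ler_powR // ltW.
have [|N lt_Ncd] := @ltr_expM_exists R (x `^ y) (c / d) _ _ x_gt0.
  by rewrite powR_ge0.
have /truncn_itv/andP[le_vN lt_Nv] : 0 <= N%:R * y by rewrite mulr_ge0 // ltW.
exists N, (Num.truncn (N%:R * y)).+1; rewrite ratE; split=> //.
apply: le_lt_trans lt_Ncd; rewrite exprS ler_pM2l //.
by rewrite -powR_natM -powR_mulrn ?(ltW x_gt0) // ler_powR.
Qed.

Lemma lt_powR_root (a b y : R) : 0 < y -> 0 <= a -> 0 <= b ->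
  (a < b `^ y) = (a `^ y^-1 < b).
Proof.
move=> y_gt0 a_ge0 b_ge0; have y_neq0 := lt0r_neq0 y_gt0.
apply/idP/idP => lt_ab.
  rewrite -[ltRHS](powRr1 b_ge0) -(mulfV y_neq0) powRrM.
  by rewrite gt0_ltr_powR ?invr_gt0 ?nnegrE ?powR_ge0.
rewrite -[ltLHS](powRr1 a_ge0) -(mulVf y_neq0) powRrM.
by rewrite gt0_ltr_powR ?nnegrE ?powR_ge0.
Qed.

Lemma powR_lt_root (a b y : R) : 0 < y -> 0 <= a -> 0 <= b ->
  (b `^ y < a) = (b < a `^ y^-1).
Proof.
by move=> y_gt0 a_ge0 b_ge0; rewrite lt_powR_root ?invr_gt0 // invrK.
Qed.

End PowerTests.

(** * Semidecidable relations and Dedekind cuts *)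

(* [Q (x, w)] is the verdict on [P x] after [w] steps of a search. *)
Definition semidecidable (D : domain) (P : D -> Prop) : Prop :=
  exists2 Q : D * nat -> bool, nat_computable (fun z => Q z) &
    forall x, (forall w, Q (x, w) -> P x) /\
              (P x -> exists w0, forall w, (w0 <= w)%N -> Q (x, w)).

Section Semidecidable.
Implicit Types (D : domain).

Lemma eq_semidecidable D (P P' : D -> Prop) :
  (forall x, P x <-> P' x) -> semidecidable P -> semidecidable P'.
Proof.
move=> PP' [Q hQ PQ]; exists Q => // x; have [sound complete] := PQ x.
by split=> [w /sound /PP' | /PP' /complete].
Qed.

Lemma semidecidable_comp D D' (P : D' -> Prop) (s : D -> D') :
  semidecidable P -> computable_map s -> semidecidable (fun x => P (s x)).
Proof.
move=> [Q hQ PQ] hs; exists (fun z => Q (s z.1, z.2)) => [|x].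
  by computability.
exact: (PQ (s x)).
Qed.

Lemma semidecidable_and D (P P' : D -> Prop) :
  semidecidable P -> semidecidable P' -> semidecidable (fun x => P x /\ P' x).
Proof.
move=> [Q hQ PQ] [Q' hQ' PQ']; exists (fun z => Q z && Q' z) => [|x].
  by computability.
have [[sound complete] [sound' complete']] := (PQ x, PQ' x); split=> [w|].
  by move=> /andP[/sound Px /sound' P'x].
move=> [/complete[w0 Qw0] /complete'[w1 Q'w1]]; exists (maxn w0 w1) => w.
by rewrite geq_max => /andP[/Qw0 -> /Q'w1].
Qed.

Lemma nat_computable_exists_lt D (Q : D * nat * nat -> bool) :
  nat_computable (fun z => Q z) ->
  nat_computable (fun z : D * nat => [exists i : 'I_z.2, Q (z.1, val i, z.2)]).
Proof.
move=> hQ; apply: (nat_computable_exists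
  (P := fun t : D * nat * nat => Q (t.1.1, t.2, t.1.2)) (N := snd));
  by computability.
Qed.

Lemma semidecidable_exists D (P : D * nat -> Prop) :
  semidecidable P -> semidecidable (fun x => exists n, P (x, n)).
Proof.
move=> [Q hQ PQ]; exists (fun z => [exists i : 'I_z.2, Q (z.1, val i, z.2)]).
  exact: nat_computable_exists_lt.
move=> x; split=> [w /existsP[i /(PQ _).1 Pxi] | [n /(PQ _).2[w0 hw0]]].
  by exists i.
exists (maxn w0 n.+1) => w; rewrite geq_max => /andP[le_w0w lt_nw].
by apply/existsP; exists (Ordinal lt_nw) => /=; apply: hw0.
Qed.

Lemma semidecidable_select D (P : D * nat -> Prop) :
  semidecidable P -> (forall x, exists n, P (x, n)) ->
  exists2 g : D -> nat, nat_computable g & forall x, P (x, g x).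
Proof.
move=> [Q hQ PQ] exP.
have [|b hb Qb] := nat_computable_mu (nat_computable_exists_lt hQ).
  move=> x; have [n /(PQ _).2[w0 hw0]] := exP x; exists (maxn w0 n.+1) => /=.
  by apply/existsP; exists (Ordinal (leq_maxr w0 n.+1)); apply/hw0/leq_maxl.
have [| |g hg Qg] := @nat_computable_mu D (fun z => Q (z, b z.1)).
- by computability.
- by move=> x; have /existsP[i Qi] := Qb x; exists i.
by exists g => // x; apply: (PQ _).1 (Qg x).
Qed.

End Semidecidable.

Section RealCuts.
Variable R : realType.
Implicit Types (D : domain).

Let exp2_gt0 m : 0 < 2 ^+ m :> R. Proof. by rewrite exprn_gt0. Qed.

Let natr_exp2_gt0 m : 0 < (2 ^ m)%:R :> R. Proof. by rewrite natrX. Qed.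

Lemma semidecidable_lt D (X Y : D -> R) :
  real_computable X -> real_computable Y -> semidecidable (fun x => X x < Y x).
Proof.
move=> [F hF FX] [G hG GY].
exists (fun z => ~~ (G z <= F z + 2%N%:Z)) => [|x].
  by apply/nat_computable_neg/int_computable_le; int_computability.
have stageE w : ~~ (G (x, w) <= F (x, w) + 2%N%:Z) =
    ((F (x, w))%:~R / 2 ^+ w + 2 * 2 ^- w < (G (x, w))%:~R / 2 ^+ w :> R).
  by rewrite -ltNge -(ltr_int R) -mulrDl ltr_pM2r ?invr_gt0 // intrD.
split=> [w | lt_XY].
  rewrite stageE; move: (FX x w) (GY x w); rewrite !ler_norml.
  by move=> /andP[? ?] /andP[? ?]; lra.
exists (Num.bound (4 / (Y x - X x))) => w /upper_nthrootP.
rewrite ltr_pdivrMr ?subr_gt0 // mulrC -ltr_pdivrMr // stageE.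
move: (FX x w) (GY x w); rewrite !ler_norml.
by move=> /andP[? ?] /andP[? ?]; lra.
Qed.

Lemma real_computable_cut D (X : D -> R) : (forall x, 0 < X x) ->
  semidecidable (fun z : D * nat * nat => z.2%:R / (2 ^ z.1.2)%:R < X z.1.1) ->
  semidecidable (fun z : D * nat * nat => X z.1.1 < z.2%:R / (2 ^ z.1.2)%:R) ->
  real_computable X.
Proof.
move=> X_gt0 lower upper.
have shift2 : computable_map (fun z : D * nat * nat => (z.1, z.2.+2)).
  by computability.
have [z|g hg Xg] := semidecidable_select
    (semidecidable_and lower (semidecidable_comp upper shift2)).
  have r_gt0 : 0 < 2 ^+ z.2 * X z.1 by rewrite mulr_gt0.
  exists (Num.truncn (2 ^+ z.2 * X z.1)).-1 => /=.
  rewrite natrX ltr_pdivrMr // ltr_pdivlMr // ![X _ * _]mulrC.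
  exact/andP/truncn_pred_itv.
exists (fun z => (g z).+1%:Z) => [|x m]; first by int_computability.
have [/= lo hi] := Xg (x, m); move: lo hi.
rewrite -pmulrn natrX -!natr1.
by rewrite !mulrDl !mul1r ler_norml => lo hi; apply/andP; split; lra.
Qed.

Lemma real_computable_inv_gt0 D (X : D -> R) : (forall x, 0 < X x) ->
  real_computable X -> real_computable (fun x => (X x)^-1).
Proof.
move=> X_gt0 hX.
have hzX : real_computable (fun z : D * nat * nat => z.2%:R * X z.1.1).
  by real_computability.
have hM : real_computable (fun z : D * nat * nat => (2 ^ z.1.2)%:R : R).
  by real_computability.
apply: real_computable_cut => [x||]; first by rewrite invr_gt0.
  apply: eq_semidecidable (semidecidable_lt hzX hM) => z.
  by rewrite ltr_pdivrMr // [_^-1 * _]mulrC ltr_pdivlMr.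
apply: eq_semidecidable (semidecidable_lt hM hzX) => z.
by rewrite -[_^-1]mul1r ltr_pdivrMr // mulrAC ltr_pdivlMr // mul1r.
Qed.

Lemma real_computable_inv D (X : D -> R) : (forall x, X x != 0) ->
  real_computable X -> real_computable (fun x => (X x)^-1).
Proof.
move=> X_neq0 hX.
apply: (@eq_real_computable _ _ (fun x => X x * (X x * X x)^-1)) => [x|].
  by rewrite invfM mulVKf.
apply: real_computable_mul => //; apply: real_computable_inv_gt0 => [x|].
  by rewrite -expr2 exprn_even_gt0 //= X_neq0.
exact: real_computable_mul.
Qed.

Lemma real_computable_natX D (f g : D -> nat) :
  nat_computable f -> nat_computable g ->
  real_computable (fun x => (f x)%:R ^+ g x : R).
Proof.
move=> hf hg; have hfg : real_computable (fun x => (f x ^ g x)%:R : R).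
  by real_computability.
by apply: eq_real_computable hfg => x; rewrite natrX.
Qed.

Lemma real_computable_pos_nat_powR D (f : D -> nat) (Y : D -> R) :
  (forall x, 0 < f x)%N -> (forall x, 0 < Y x) ->
  nat_computable f -> real_computable Y ->
  real_computable (fun x => (f x)%:R `^ Y x).
Proof.
move=> f_gt0 Y_gt0 hf hY.
have f_ge1 x : 1 <= (f x)%:R :> R by rewrite ler1n.
(* [(x, m, c, N, v) : E] compares [f x `^ Y x] to [c / 2 ^ m] via [v / N]. *)
pose E : domain := (D * nat * nat * nat * nat)%type.
have hv : real_computable (fun t : E => t.2%:R : R) by real_computability.
have hNY : real_computable (fun t : E => t.1.2%:R * Y t.1.1.1.1).
  by real_computability.
have hcN : real_computable (fun t : E => t.1.1.2%:R ^+ t.1.2 : R).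
  by apply: real_computable_natX; computability.
have hfv : real_computable
    (fun t : E => (f t.1.1.1.1)%:R ^+ t.2 * (2 ^ t.1.1.1.2)%:R ^+ t.1.2 : R).
  by apply: real_computable_mul; apply: real_computable_natX; computability.
apply: real_computable_cut => [x||]; first by rewrite powR_gt0 ?ltr0n.
  have := semidecidable_exists (semidecidable_exists (semidecidable_and
    (semidecidable_lt hv hNY) (semidecidable_lt hcN hfv))).
  by apply: eq_semidecidable => z; apply: iff_sym; apply: lt_powR_ratP.
have := semidecidable_exists (semidecidable_exists (semidecidable_and
  (semidecidable_lt hNY hv) (semidecidable_lt hfv hcN))).
by apply: eq_semidecidable => z; apply: iff_sym; apply: powR_lt_ratP.
Qed.

Lemma real_computable_nat_powR D (f : D -> nat) (Y : D -> R) :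
  (forall x, 0 < Y x) -> nat_computable f -> real_computable Y ->
  real_computable (fun x => (f x)%:R `^ Y x).
Proof.
move=> Y_gt0 hf hY; apply: (@eq_real_computable _ _
  (fun x => if (0 < f x)%N then (f x).-1.+1%:R `^ Y x else 0%:R)) => [x|].
  by case: (f x) => //=; rewrite powR0 // gt_eqF.
apply: real_computable_if; first by computability.
  by apply: real_computable_pos_nat_powR => //; computability.
exact: real_computable_const.
Qed.

Lemma real_computable_powR D (X Y : D -> R) :
  (forall x, 0 < X x) -> (forall x, 0 < Y x) ->
  real_computable X -> real_computable Y ->
  real_computable (fun x => X x `^ Y x).
Proof.
move=> X_gt0 Y_gt0 hX hY.
have hYV : real_computable (fun z : D * nat * nat => (Y z.1.1)^-1).
  by apply: real_computable_inv_gt0 => //; real_computability.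
have YV_gt0 (z : D * nat * nat) : 0 < (Y z.1.1)^-1 by rewrite invr_gt0.
have hc : real_computable (fun z : D * nat * nat => z.2%:R `^ (Y z.1.1)^-1).
  by apply: real_computable_nat_powR => //; computability.
have hdX : real_computable
    (fun z : D * nat * nat => (2 ^ z.1.2)%:R `^ (Y z.1.1)^-1 * X z.1.1).
  apply: real_computable_mul; last by real_computability.
  by apply: real_computable_nat_powR => //; computability.
have scaleE (z : D * nat * nat) : (2 ^ z.1.2)%:R * X z.1.1 `^ Y z.1.1 =
    ((2 ^ z.1.2)%:R `^ (Y z.1.1)^-1 * X z.1.1) `^ Y z.1.1.
  rewrite powRM ?powR_ge0 ?(ltW (X_gt0 _)) //.
  by rewrite -powRrM mulVf ?lt0r_neq0 // powRr1.
have dX_ge0 (z : D * nat * nat) : 0 <= (2 ^ z.1.2)%:R `^ (Y z.1.1)^-1 * X z.1.1.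
  by rewrite mulr_ge0 ?powR_ge0 // ltW.
apply: real_computable_cut => [x||]; first by rewrite powR_gt0.
  apply: eq_semidecidable (semidecidable_lt hc hdX) => z.
  by rewrite ltr_pdivrMr // [X _ `^ _ * _]mulrC scaleE lt_powR_root.
apply: eq_semidecidable (semidecidable_lt hdX hc) => z.
by rewrite ltr_pdivlMr // [X _ `^ _ * _]mulrC scaleE powR_lt_root.
Qed.

End RealCuts.

(** * Computing the parallelepiped *)

Lemma nat_computable_bit (D : domain) (f g : D -> nat) :
  nat_computable f -> nat_computable g ->
  nat_computable (fun x => bit (f x) (g x)).
Proof.
move=> hf hg; have hfg : nat_computable (fun x => odd (f x %/ 2 ^ g x)).
  by computability.
by apply: eq_nat_computable hfg => x; rewrite bitE.
Qed.

Lemma nat_computable_weight_bit (D : domain) (k v : D -> nat) :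
  nat_computable k -> nat_computable v ->
  nat_computable (fun x => weight (k x) (bit (v x))).
Proof.
move=> hk hv; apply: (nat_computable_sum (f := fun z => bit (v z.1) z.2)) => //.
by apply: nat_computable_bit; computability.
Qed.

Lemma real_computable_walsh (R : realType) (D : domain) (k S v : D -> nat) :
  nat_computable k -> nat_computable S -> nat_computable v ->
  real_computable (fun x => walsh (k x) (S x) (bit (v x)) : R).
Proof.
move=> hk hS hv; apply: real_computable_sign.
apply: (nat_computable_sum
  (f := fun z => bit (S z.1) z.2 && bit (v z.1) z.2)) => //.
by apply: nat_computable_and; apply: nat_computable_bit; computability.
Qed.

Section ComputableParallelepiped.
Variables (R : realType) (D : domain) (p : D -> R) (k : D -> nat).
Hypothesis p_gt0 : forall x, 0 < p x.
Hypothesis p_cond : forall x, p x \isn't a Num.int \/ (k x)%:R <= p x.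
Hypothesis hp : real_computable p.
Hypothesis hk : nat_computable k.

Let eigenvalue x := walsh_eigenvalue (k x) (odd_powR (p x)).

Lemma real_computable_eigenvalue :
  real_computable (fun z : D * nat => eigenvalue z.1 z.2).
Proof.
apply: (real_computable_sum (X := fun t : D * nat * nat =>
    walsh (k t.1.1) t.1.2 (bit t.2) *
    odd_powR (p t.1.1) (weight (k t.1.1) (bit t.2)))
  (N := fun z => (2 ^ k z.1)%N)); last by computability.
have hw : nat_computable (fun t : D * nat * nat => weight (k t.1.1) (bit t.2)).
  by apply: nat_computable_weight_bit; computability.
apply: real_computable_mul.
  by apply: real_computable_walsh; computability.
apply: real_computable_powR => [t|t||]; first by rewrite ltr_pwDl ?mulr_ge0.
- exact: p_gt0.
- by real_computability.
by real_computability.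
Qed.

Lemma real_computable_eigenvalueV :
  real_computable (fun z : D * nat => (eigenvalue z.1 z.2)^-1).
Proof.
apply: real_computable_inv real_computable_eigenvalue => z.
exact: odd_powR_eigenvalue_neq0.
Qed.

Lemma real_computable_inv_eigenvalue_bound :
  real_computable (fun x => inv_eigenvalue_bound (k x) (odd_powR (p x))).
Proof.
have hV := real_computable_eigenvalueV.
apply: real_computable_add; first exact: (real_computable_const _ _ 1).
apply: (real_computable_sum (X := fun z => 1 + (eigenvalue z.1 z.2)^-1 ^+ 2)
  (N := fun x => (2 ^ k x)%N)); last by computability.
by real_computability.
Qed.

Lemma real_computable_power_weight :
  real_computable (fun z : D * nat => power_weight (p z.1) (k z.1) z.2).
Proof.
have hB : real_computable
    (fun z : D * nat => inv_eigenvalue_bound (k z.1) (odd_powR (p z.1))).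
  by apply: (real_computable_comp real_computable_inv_eigenvalue_bound);
    computability.
apply: real_computable_mul.
  apply: real_computable_add => //.
  apply: (real_computable_sum (X := fun t : D * nat * nat =>
      walsh (k t.1.1) t.2 (bit t.1.2) / eigenvalue t.1.1 t.2)
    (N := fun z => (2 ^ k z.1)%N)); last by computability.
  apply: real_computable_mul.
    by apply: real_computable_walsh; computability.
  by apply: (real_computable_comp real_computable_eigenvalueV
    (s := fun t => (t.1.1, t.2))); computability.
apply: real_computable_inv_gt0 => [z|].
  exact/bump_scale_gt0/odd_powR_eigenvalue0_gt0.
apply: real_computable_mul => //.
by apply: (real_computable_comp real_computable_eigenvalue
  (s := fun z => (z.1, 0%N))); computability.
Qed.

Lemma real_computable_power_entry : real_computable
  (fun z : D * nat * nat => power_entry (p z.1.1) (k z.1.1) z.1.2 z.2).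
Proof.
have hw : nat_computable
    (fun z : D * nat * nat => weight (k z.1.1) (bit z.1.2)).
  by apply: nat_computable_weight_bit; computability.
have hb : nat_computable (fun z : D * nat * nat => bit z.1.2 z.2).
  by apply: nat_computable_bit; computability.
apply: real_computable_mul; first by real_computability.
apply: real_computable_powR => [z|z||].
- exact: power_weight_gt0.
- by rewrite invr_gt0.
- by apply: (real_computable_comp real_computable_power_weight); computability.
by apply: real_computable_inv_gt0 => //; real_computability.
Qed.

End ComputableParallelepiped.

Record query (R : realType) := Query {
  exponent_name : nat -> nat;
  exponent : R;
  dimension : nat;
  row_index : nat;
  column_index : nat;
  precision : nat;
  exponent_gt0 : 0 < exponent;
  exponent_cond : exponent \isn't a Num.int \/ dimension%:R <= exponent;
  names_exponent : names exponent_name exponent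
}.

Section QueryAlgorithm.
Variable R : realType.
Implicit Types (q : query R).

Let query_args q := [:: dimension q; row_index q; column_index q; precision q].

Let size_query_args q : size (query_args q) = 4%N.
Proof. by []. Qed.

Canonical query_domain : domain := Domain (@exponent_name R) size_query_args.

Lemma real_computable_exponent : real_computable (@exponent R).
Proof.
exists (fun z => int_of_code (exponent_name z.1 z.2)) => [|q m].
  apply: int_computable_of_code.
  by apply: (@nat_computable_oracle (query R * nat)%type snd); computability.
exact: names_exponent.
Qed.

Lemma power_entry_algorithm : exists c : prog, forall q, exists y,
  Defs.eval (exponent_name q) c (query_args q) y /\
  approximates (precision q) y
    (power_entry (exponent q) (dimension q) (row_index q) (column_index q)).
Proof.
have hk : nat_computable (@dimension R) := nat_computable_arg query_domain 0.
have hi : nat_computable (@row_index R) := nat_computable_arg query_domain 1.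
have hj : nat_computable (@column_index R) := nat_computable_arg query_domain 2.
have hm : nat_computable (@precision R) := nat_computable_arg query_domain 3.
have [F hF F_approx] := real_computable_power_entry
  (@exponent_gt0 R) (@exponent_cond R) real_computable_exponent hk.
have [|f [c hc] fF] := @int_computable_code query_domain
    (fun q => F (q, row_index q, column_index q, precision q)).
  by int_computability.
exists c => q; exists (f q); split; first exact: hc.
rewrite /approximates fF; exact: (F_approx (q, _, _)).
Qed.

End QueryAlgorithm.

Theorem theorem3p1 (R : realType) :
  (forall (k : nat) (p : R),
     (0 < k)%N -> 1 <= p -> p \isn't a Num.int \/ k%:R <= p ->
     exists (V : 'M[R]_(2 ^ k, k)) (t : 'cV[R]_(2 ^ k)),
       isolating_parallelepiped p V t)
  /\
  (exists c : prog,
     forall (k : nat) (p : R),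
       (0 < k)%N -> 1 <= p -> p \isn't a Num.int \/ k%:R <= p ->
       computable_real p ->
       forall phi : nat -> nat, names phi p ->
       exists (V : 'M[R]_(2 ^ k, k)) (t : 'cV[R]_(2 ^ k)),
         isolating_parallelepiped p V t
         /\ outputs_matrix c phi k (row_mx V t)).
Proof.
have p_gt0 (p : R) : 1 <= p -> 0 < p by exact: lt_le_trans.
split=> [k p _ /p_gt0 p0 p_cond|].
  exists (power_parallelepiped p k), (power_target p k).
  exact: isolating_power_parallelepiped.
have [c hc] := power_entry_algorithm R; exists c.
move=> k p _ /p_gt0 p0 p_cond _ phi names_p.
exists (power_parallelepiped p k), (power_target p k).
split=> [|i j prec]; first exact: isolating_power_parallelepiped.
by rewrite row_mx_cube_entry; exact: (hc (Query i j prec p0 p_cond names_p)).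
Qed.
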